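(* Let $n \geq 6$. Then $$F(G_{3,1}^{(n)}) > F(G_{3,2}^{(n)}) > F(G_{3,1}^{'(n)}) = F(G_{4,1}^{(n)}) > F(G_{3,3}^{(n)}) > F(G_{3,4}^{(n)}),$$ and every unicyclic graph of order $n$ not isomorphic to one of these six graphs has F-index strictly less than $F(G_{3,4}^{(n)})$. That is, these are the unicyclic graphs of order $n$ with the largest F-indices, in the order listed.
   Context: All graphs are finite and simple. For a graph $G$, the F-index is $F(G)=\sum_{v\in V(G)} d_G(v)^3$, where $d_G(v)$ is the degree of $v$. A unicyclic graph is a connected graph containing exactly one cycle. A leaf is a vertex of degree $1$; ''attaching $m$ leaves to a vertex $x$'' means adding $m$ new vertices, each adjacent only to $x$. Definitions: $G_{k,1}^{(n)}$ ($3\le k\le n$) is the graph obtained from the cycle $C_k$ by attaching $n-k$ leaves to one vertex of the cycle. $G_{k,2}^{(n)}$ ($3\le k\le n-1$) is obtained from $C_k$ by attaching $n-k-1$ leaves to one cycle vertex $u$ and one leaf to a cycle vertex adjacent to $u$. $G_{3,1}^{'(n)}$ is obtained from $G_{3,1}^{(n-1)}$ by attaching one new leaf to one of its leaves. $G_{3,3}^{(n)}$ is obtained from a triangle $xyz$ by attaching $n-5$ leaves to $x$ and $2$ leaves to $y$. $G_{3,4}^{(n)}$ is obtained from a triangle $xyz$ by attaching $n-5$ leaves to $x$, one leaf to $y$ and one leaf to $z$. All these graphs have $n$ vertices.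
   Formalization: The inequality F(G_{4,1}) > F(G_{3,3}) is claimed only for n ≥ 7, since at n = 6 it fails (90 versus 102, where G_{3,3} is isomorphic to G_{3,2}); F(G_{4,1}) > F(G_{3,4}) and all other claims are kept for n ≥ 6. *)

(* Defs.v *)
From mathcomp Require Import all_boot all_order all_algebra.

Set Implicit Arguments.
Unset Strict Implicit.
Unset Printing Implicit Defensive.

Import GRing.Theory.

Record sgraph := SGraph {
  vert :> finType;
  adj : rel vert;
  adj_sym : symmetric adj;
  adj_irr : irreflexive adj }.

Arguments adj {s}.

Definition order_of (G : sgraph) : nat := #|G|.

Definition deg (G : sgraph) (v : G) : nat := #|[set u : G | adj v u]|.

Definition F_index (G : sgraph) : nat := \sum_(v : G) deg v ^ 3.

Definition isomorphic (G H : sgraph) : Prop :=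
  exists f : G -> H,
    bijective f /\ (forall x y : G, adj (f x) (f y) = adj x y).

Definition connected (G : sgraph) : Prop :=
  forall x y : G, connect (@adj G) x y.

(* A cycle of a graph is a subgraph, so it is identified with its edge set: the
   vertex sequences that differ by a rotation or a reversal give the same
   cycle.  Edges are two-element vertex sets. *)
Definition cycle_edges (G : sgraph) (c : seq G) : {set {set G}} :=
  [set [set x; next c x] | x in c].

Definition is_cycle (G : sgraph) (E : {set {set G}}) : Prop :=
  exists c : seq G, [/\ 2 < size c, ucycle (@adj G) c & E = cycle_edges c].

Definition unicyclic (G : sgraph) : Prop :=
  connected G /\ (exists! E : {set {set G}}, is_cycle E).

Definition cycle_adj (k : nat) : rel 'Z_k :=
  fun i j => (j == i + 1)%R || (i == j + 1)%R.

Lemma cycle_adj_sym k : symmetric (@cycle_adj k).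
Proof. by move=> i j; rewrite /cycle_adj orbC. Qed.

Lemma cycle_adj_irr k : irreflexive (@cycle_adj k).
Proof.
by move=> i; rewrite /cycle_adj orbb -{1}[i]addr0 (inj_eq (addrI i)) eq_sym
  oner_eq0.
Qed.

(* The cycle C_k; only meaningful for k >= 3 (for k <= 2 it is one edge). *)
Definition cycle_graph (k : nat) : sgraph :=
  SGraph (@cycle_adj_sym k) (@cycle_adj_irr k).

Definition attach_adj (G : sgraph) (x : G) (m : nat) : rel (G + 'I_m)%type :=
  fun u v => match u, v with
  | inl a, inl b => adj a b
  | inl a, inr _ => a == x
  | inr _, inl b => b == x
  | inr _, inr _ => false
  end.

Lemma attach_adj_sym (G : sgraph) (x : G) m : symmetric (attach_adj x (m := m)).
Proof. by move=> [a|i] [b|j] //=; rewrite adj_sym. Qed.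

Lemma attach_adj_irr (G : sgraph) (x : G) m :
  irreflexive (attach_adj x (m := m)).
Proof. by move=> [a|i] //=; rewrite adj_irr. Qed.

(* G with m leaves attached to x; the old vertices are [inl v] and the new
   leaves [inr i]. *)
Definition attach (G : sgraph) (x : G) (m : nat) : sgraph :=
  SGraph (@attach_adj_sym G x m) (@attach_adj_irr G x m).

(* In the graphs below, the vertices 0, 1 (and 2) of the cycle are used as
   u and its neighbour, respectively as x, y, z. *)

(* Meaningful for 3 <= k <= n. *)
Definition Gk1 (k n : nat) : sgraph :=
  @attach (cycle_graph k) (0%R : 'Z_k) (n - k).

(* Meaningful for 3 <= k <= n - 1. *)
Definition Gk2 (k n : nat) : sgraph :=
  @attach (@attach (cycle_graph k) (0%R : 'Z_k) (n - k - 1))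
    (inl (1%R : 'Z_k)) 1.

(* A leaf exists as soon as 4 <= n; the default value is then irrelevant. *)
Definition G31_leaf (n : nat) : Gk1 3 n :=
  odflt (inl (0%R : 'Z_3)) [pick v : Gk1 3 n | deg v == 1].

Definition G31' (n : nat) : sgraph :=
  @attach (Gk1 3 (n - 1)) (G31_leaf (n - 1)) 1.

Definition G33 (n : nat) : sgraph :=
  @attach (@attach (cycle_graph 3) (0%R : 'Z_3) (n - 5))
    (inl (1%R : 'Z_3)) 2.

Definition G34 (n : nat) : sgraph :=
  @attach
    (@attach (@attach (cycle_graph 3) (0%R : 'Z_3) (n - 5))
       (inl (1%R : 'Z_3)) 1)
    (inl (inl (2%:R%R : 'Z_3))) 1.

(* Main.v *)
Require Import Defs.
From mathcomp Require Import all_boot all_order all_algebra perm zify ring.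

(* In a unicyclic graph every vertex v has a successor p v (the next vertex on
   the cycle, or a neighbour closer to the cycle) such that the edges are
   exactly the pairs {v, p v}, without repetition; so the degrees sum to 2n.  Let
   a >= b >= c be the three largest values of deg - 1, attained at x, y, z, and
   r the sum of deg - 1 over the other vertices, so that a + b + c + r = n and
   c >= 1 because of the cycle.  By convexity the F-index is smaller than that
   of G34 whenever b + c + r >= 5, and also for (b, c, r) = (2, 1, 1) and
   (1, 1, 2).  If r = 0, then x, y, z form the cycle and all other vertices are
   leaves, so the degrees of y and z determine the graph: (b, c) = (1, 1),
   (2, 1), (3, 1), (2, 2) give G31, G32, G33, G34.  The remaining case
   (b, c, r) = (1, 1, 1) has a single vertex not adjacent to x: it is a leaf in
   G31' and a vertex of degree 2 in G41. *)

Set Implicit Arguments.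
Unset Strict Implicit.
Unset Printing Implicit Defensive.

(** * The cubic inequality *)

Lemma cubeS x : x.+1 ^ 3 = x ^ 3 + 3 * (x * x.+1) + 1.
Proof. by rewrite !expnS expn0; ring. Qed.

(* With n = a + b + c + r vertices, a.+1 >= b.+1 >= c.+1 are the three largest
   degrees, the remaining degrees exceed 1 by r in total, and m = n - 5 - a, so
   a + m + 2 = n - 3 is the largest degree of G34.  The induction on m moves
   one unit of degree from b, c or r to a, which increases the left-hand side
   since a is the largest. *)
Lemma cube_gap m a b c r : 0 < c -> c <= b -> b <= a -> b + c + r = m + 5 ->
  a.+1 ^ 3 + (b.+1 ^ 3 + (c.+1 ^ 3 + r * (3 + 3 * c + c * c)))
    < (a + m + 2) ^ 3 + 54.
Proof.
elim: m a b c r => [|m IH] a b c r c0 cb ba s.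
  (* Base case: [b + c + r = 5] and [c <= b] force [c] to be 1 or 2, which leaves six triples. *)
  case: c c0 cb s => [|[|[|c]]] // _ cb s; last by lia.
  - case: r s => [|[|[|[|r]]]] s; last by lia.
    + have -> : b = 4 by lia.
      by rewrite addn0 addn2 (cubeS a.+1); nia.
    + have -> : b = 3 by lia.
      by rewrite addn0 addn2 (cubeS a.+1); nia.
    + have -> : b = 2 by lia.
      by rewrite addn0 addn2 (cubeS a.+1); nia.
    + have -> : b = 1 by lia.
      by rewrite addn0 addn2 (cubeS a.+1); nia.
  - case: r s => [|[|r]] s; last by lia.
    + have -> : b = 3 by lia.
      by rewrite addn0 addn2 (cubeS a.+1); nia.
    + have -> : b = 2 by lia.
      by rewrite addn0 addn2 (cubeS a.+1); nia.
(* [d] bounds what the terms in [b], [c] and [r] lose by the transfer; raising [a] gains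
   [3 * (a.+1 * a.+2) + 1]. *)
have step b' c' r' d : 0 < c' -> c' <= b' -> b' <= a -> b' + c' + r' = m + 5 ->
  b.+1 ^ 3 + (c.+1 ^ 3 + r * (3 + 3 * c + c * c)) <=
  b'.+1 ^ 3 + (c'.+1 ^ 3 + r' * (3 + 3 * c' + c' * c')) + d ->
  d <= 3 * (a.+1 * a.+2) + 1 ->
  a.+1 ^ 3 + (b.+1 ^ 3 + (c.+1 ^ 3 + r * (3 + 3 * c + c * c)))
    < (a + m.+1 + 2) ^ 3 + 54.
  move=> c'0 cb' ba' s' le_d le_a.
  have := IH a.+1 b' c' r' c'0 cb' (leqW ba') s'.
  by rewrite (cubeS a.+1) addSnnS; lia.
(* The unit is taken from [r] if possible, then from [b] if [c < b], and otherwise from [c], so that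
   [c' <= b'] persists. *)
case: r s step => [|r] s step; last first.
  by apply: (step b c r (3 + 3 * c + c * c)) => //; [lia|lia|nia].
have [cb1|bc] := ltnP c b.
  case: b cb ba s cb1 step => // b cb ba s cb1 step.
  apply: (step b c 0 (3 * (b.+1 * b.+2) + 1)); [by []|lia|lia|lia| |nia].
  by rewrite (cubeS b.+1); lia.
case: c c0 cb s bc step => // c _ cb s bc step.
apply: (step b c 0 (3 * (c.+1 * c.+2) + 1)); [lia|lia|lia|lia| |nia].
by rewrite (cubeS c.+1); lia.
Qed.

(** * Orientation of unicyclic graphs *)

Lemma next_next_neq (T : eqType) (c : seq T) x :
  uniq c -> 2 < size c -> x \in c -> next c (next c x) != x.
Proof.
move=> uc sc xc; have [i s def_c] := rot_to xc.
have : uniq (x :: s) by rewrite -def_c rot_uniq.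
have : 2 < size (x :: s) by rewrite -def_c size_rot.
rewrite -!(next_rot i uc) def_c; case: s {def_c} => [|y [|z s]] //= _.
rewrite !inE !negb_or eqxx => /andP[/and3P[xy xz _] _].
by rewrite [y == x]eq_sym (negPf xy) eqxx eq_sym.
Qed.

Lemma next_neq_prev (T : eqType) (c : seq T) x :
  uniq c -> 2 < size c -> x \in c -> next c x != prev c x.
Proof.
move=> uc sc xc; apply/eqP => /(congr1 (next c)); rewrite next_prev //.
exact/eqP/next_next_neq.
Qed.

Lemma doubleton_eq (T : finType) (u v x y : T) :
  [set u; v] = [set x; y] -> (u = x /\ v = y) \/ (u = y /\ v = x).
Proof.
move=> /setP E; have := (E u, E v, E x, E y); rewrite !inE !eqxx /= !orbT.
do ![case: eqP => //= ?]; subst; auto; case => [[[]]] //=.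
Qed.

(** A path from [u] to [v] inside [R], shortened until no vertex repeats, is closed up by the edge
    [uv]. It has at least two steps since [R u v] fails, so the resulting cycle has length above
    2. *)
Lemma cycle_through (G : sgraph) (u v : G) (R : rel G) :
  subrel R adj -> symmetric R -> adj u v -> ~~ R u v -> connect R u v ->
  exists2 E : {set {set G}}, is_cycle E & [set u; v] \in E.
Proof.
move=> sub_R sym_R uv nR /connectP[q pq vE].
case/shortenP: pq vE => q' pq' uq' _ vE.
have neq_uv : u != v by apply: contraTneq uv => ->; rewrite adj_irr.
case/lastP: q' pq' uq' vE => [|q' w] pq' uq' vE.
  by rewrite vE eqxx in neq_uv.
rewrite last_rcons in vE; subst w.
exists (cycle_edges (v :: u :: q')); last first.
  apply/imsetP; exists v; first by rewrite inE eqxx.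
  by rewrite /= eqxx setUC.
have uc : uniq (v :: u :: q').
  by rewrite -(rotr1_rcons v (u :: q')) rotr_uniq.
exists (v :: u :: q'); split=> //.
  case: q' pq' {uq' uc} => [|//] /=; rewrite andbT => Ruv.
  by rewrite Ruv in nR.
rewrite /ucycle uc andbT /= adj_sym uv /=.
exact: sub_path pq'.
Qed.

(** [d] is the distance to [C]: the first step of a shortest path into [C] lowers it. *)
Lemma distance_to (G : sgraph) (x0 : G) (C : pred G) :
  connected G -> C x0 ->
  exists d : G -> nat, forall v, ~~ C v -> exists2 u, adj v u & d u < d v.
Proof.
move=> conG Cx0.
pose near v k := [exists t : k.-tuple G, path adj v t && C (last v t)].
have near_ex v : exists k, near v k.
  have /connectP[p pp E] := conG v x0.
  by exists (size p); apply/existsP; exists (in_tuple p); rewrite pp -E.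
exists (fun v => ex_minn (near_ex v)) => v nCv.
case: ex_minnP => k /existsP[[[|u t] /= /eqP sz]].
  by move=> Cv _; rewrite Cv in nCv.
move=> /andP[/andP[vu pt] Ct] _.
exists u => //; case: ex_minnP => l _ min_l.
rewrite -sz ltnS; apply: min_l; apply/existsP; exists (in_tuple t).
by rewrite pt.
Qed.

(* Following p leads along the cycle on the cycle, and one step closer to the
   cycle off it.  An edge not of the form {u, p u} would lie on a second cycle,
   since the edges {u, p u} already connect the graph. *)
Lemma unicyclic_orientation (G : sgraph) : unicyclic G ->
  exists p : G -> G,
    (forall u v, adj u v = (p u == v) || (p v == u)) /\
    (forall v, p (p v) != v).
Proof.
case=> conG [E [[c [sc /andP[cc uc] def_E]] uniqE]].
have [x0 x0c] : exists x0, x0 \in c.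
  by case: (c) sc => // x s _; exists x; rewrite mem_head.
have [d dP] := distance_to (C := [in c]) conG x0c.
(* Off the cycle [dP] provides a vertex to pick, so the default [v] never occurs. *)
pose p v := if v \in c then next c v
            else odflt v [pick u | adj v u && (d u < d v)].
have p_out v : v \notin c -> adj v (p v) && (d (p v) < d v).
  move=> nvc; rewrite /p (negPf nvc); case: pickP => //= none.
  by have [u vu du] := dP v nvc; move: (none u); rewrite vu du.
have adj_p v : adj v (p v).
  have [vc|/p_out/andP[]//] := boolP (v \in c).
  by rewrite /p vc; apply: next_cycle.
pose R u v := (p u == v) || (p v == u).
have sub_R : subrel R adj.
  by move=> u v /orP[] /eqP <-; rewrite // adj_sym.
have sym_R : symmetric R by move=> u v; rewrite /R orbC.
have csym_R := sym_connect_sym sym_R.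
have to_c v : exists2 w, w \in c & connect R v w.
  have [k] := ubnP (d v); elim: k v => // k IH v; rewrite ltnS => dk.
  have [vc|/p_out/andP[_ dp]] := boolP (v \in c); first by exists v.
  have [w wc pw] := IH (p v) (leq_trans dp dk); exists w => //.
  by apply: connect_trans pw; apply: connect1; rewrite /R eqxx.
have cycR : cycle R c.
  apply: (sub_in_cycle (P := mem c) _ _ (cycle_next uc)); last exact/allP.
  by move=> u v uc' _ /eqP <-; rewrite /R /p [u \in c]uc' eqxx.
have con_R u v : connect R u v.
  have [u' u'c uu'] := to_c u; have [v' v'c vv'] := to_c v.
  apply: connect_trans uu' _; rewrite csym_R; apply: connect_trans vv' _.
  by rewrite csym_R; apply: (connect_cycle cycR).
exists p; split=> [u v|v].
  apply/idP/idP => [uv|/sub_R//]; apply/negPn/negP => nR.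
  have [E' cE' uvE'] := cycle_through sub_R sym_R uv nR (con_R u v).
  (* By uniqueness the new cycle is [E], whose edges join some [w] to [next c w] and hence belong to
     [R]. *)
  move: uvE'; rewrite -(uniqE _ cE') def_E => /imsetP[w wc].
  case/doubleton_eq => -[uw vw]; case/negP: nR; rewrite uw vw /R /p wc eqxx //.
  by rewrite orbT.
(* On the cycle the claim holds because its length exceeds 2. Off the cycle, either [p v] lies on it
   and so does [p (p v)], or [d] drops twice. *)
have [vc|nvc] := boolP (v \in c).
  by rewrite /p vc mem_next vc next_next_neq.
have /andP[_ dv] := p_out v nvc.
have [pvc|npvc] := boolP (p v \in c).
  by apply: contraNneq nvc => <-; rewrite {1}/p pvc mem_next.
have /andP[_ dpv] := p_out _ npvc.
by apply: contraTneq (ltn_trans dpv dv) => ->; rewrite ltnn.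
Qed.

Lemma deg_gt1 (G : sgraph) (v u w : G) :
  adj v u -> adj v w -> u != w -> 1 < deg v.
Proof.
move=> vu vw uw; have <- : #|[set u; w]| = 2 by rewrite cards2 uw.
by apply/subset_leq_card/subsetP => x /set2P[] ->; rewrite inE.
Qed.

Lemma leaf_adj (G : sgraph) (v u : G) :
  deg v = 1 -> adj v u -> forall w, adj v w = (w == u).
Proof.
move=> /eqP/cards1P[x /setP vx] vu w; move: (vx u) (vx w).
by rewrite !inE vu => /esym/eqP ->.
Qed.

(** The neighbours of [v] are [p v] and the preimages of [v] under [p]; since [p (p v) != v], the
    vertex [p v] is not among the latter. *)
Lemma oriented_deg (G : sgraph) (p : G -> G) (v : G) :
  (forall u v, adj u v = (p u == v) || (p v == u)) ->
  (forall v, p (p v) != v) ->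
  deg v = (#|[set u | p u == v]|).+1.
Proof.
move=> pE pp; rewrite /deg -add1n.
have -> : [set u | adj v u] = p v |: [set u | p u == v].
  by apply/setP => u; rewrite !inE pE eq_sym.
by rewrite cardsU1 inE pp.
Qed.

(** The fibres of [p] partition the vertices, so their sizes add up to the order; the extra 1 in
    each degree gives the order once more. *)
Lemma unicyclic_sum_deg (G : sgraph) :
  unicyclic G -> \sum_(v : G) deg v = 2 * order_of G.
Proof.
case/unicyclic_orientation => p [pE pp].
under eq_bigr => v _ do rewrite (oriented_deg v pE pp) -addn1.
rewrite big_split /= sum1_card mulSn mul1n; congr (_ + _).
rewrite /order_of -[RHS]sum1_card [RHS](partition_big p xpredT) //=.
by apply: eq_bigr => v _; rewrite sum1dep_card.
Qed.

Lemma unicyclic_deg_gt0 (G : sgraph) (v : G) : unicyclic G -> 0 < deg v.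
Proof.
by case/unicyclic_orientation => p [pE pp]; rewrite (oriented_deg v pE pp).
Qed.

(** A leaf [u] has no preimage under [p], so its neighbour [v] must be [p u], which has the preimage
    [u]. *)
Lemma unicyclic_leaf_nbr (G : sgraph) (u v : G) :
  unicyclic G -> deg u = 1 -> adj u v -> 1 < deg v.
Proof.
case/unicyclic_orientation => p [pE pp].
rewrite pE !(oriented_deg _ pE pp) ltnS => -[u0].
case/orP => puv; apply/card_gt0P; first by exists u; rewrite inE.
by move/eqP: u0; rewrite cards_eq0 => /eqP/setP/(_ v); rewrite !inE puv.
Qed.

Lemma cycle_deg_gt1 (G : sgraph) (c : seq G) (v : G) :
  2 < size c -> ucycle adj c -> v \in c -> 1 < deg v.
Proof.
move=> sc /andP[cc uc] vc; apply: (deg_gt1 (u := next c v) (w := prev c v)).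
- exact: next_cycle.
- by rewrite adj_sym; apply: prev_cycle.
- exact: next_neq_prev.
Qed.

(** * Attaching leaves *)

Lemma connect_invariant (T : finType) (e : rel T) (P : {pred T}) x y :
  (forall u v, e u v -> u \in P -> v \in P) ->
  connect e x y -> x \in P -> y \in P.
Proof.
move=> inv /connectP[p pp ->]; elim: p x pp => //= z p IH x /andP[xz pp] Px.
by apply: IH pp _; apply: inv xz Px.
Qed.

(** Each vertex of a cycle has both its neighbours on it, so by connectedness every cycle passes
    through all vertices and uses all edges. Hence any two cycles have the same edge set. *)
Lemma regular2_unicyclic (G : sgraph) (c : seq G) :
  connected G -> (forall v : G, deg v = 2) -> 2 < size c -> ucycle adj c ->
  unicyclic G.
Proof.
move=> conG deg2 sc ucc; split=> //; exists (cycle_edges c).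
split=> [|E]; first by exists c.
case=> c' [sc' ucc' ->]; move: c c' sc ucc sc' ucc'.
suff edges (c : seq G) : 2 < size c -> ucycle adj c ->
    cycle_edges c = [set [set e.1; e.2] | e : G * G & adj e.1 e.2].
  by move=> c c' *; rewrite !edges.
move=> sc /andP[cc uc].
have nbr u v : u \in c -> adj u v -> v = next c u \/ v = prev c u.
  move=> uIc uv.
  have sub : [set next c u; prev c u] \subset [set w | adj u w].
    apply/subsetP => w /set2P[] ->; rewrite inE; first exact: next_cycle.
    by rewrite adj_sym; apply: prev_cycle.
  have := deg2 u; rewrite /deg => card2.
  have /eqP nbE : [set next c u; prev c u] == [set w | adj u w].
    by rewrite eqEcard sub card2 cards2 next_neq_prev.
  by move/setP/(_ v): nbE; rewrite !inE uv => /orP[] /eqP; [left | right].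
have all_c v : v \in c.
  case: (c) sc nbr => // x0 s _ nbr.
  apply: (connect_invariant (P := mem (x0 :: s)) _ (conG x0 v)).
    move=> y z yz yc; case: (nbr y z yc yz) => ->.
      by rewrite mem_next.
    by rewrite mem_prev.
  exact: mem_head.
apply/setP => e; apply/imsetP/imsetP => [[u uIc ->]|[[u v]]].
  by exists (u, next c u); rewrite ?inE //; apply: next_cycle.
rewrite inE /= => uv ->; case: (nbr u v (all_c u) uv) => ->.
  by exists u.
by exists (prev c u); rewrite ?mem_prev // next_prev // setUC.
Qed.

Section Attach.
Variables (G : sgraph) (x : G) (m : nat).
Let A := attach x m.

Lemma cycle_edges_attach (c : seq G) : uniq c ->
  cycle_edges (map inl c : seq A) =
    [set [set (inl v : A) | v in e] | e : {set G} in cycle_edges c].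
Proof.
move=> uc; have inl_inj : injective (@inl G 'I_m) by move=> ? ? [].
apply/setP => e; apply/imsetP/imsetP => [[_ /mapP[u uc' ->] ->]|].
  exists [set u; next c u]; first exact: imset_f.
  by rewrite imsetU1 imset_set1 (next_map inl_inj).
case=> _ /imsetP[u uc' ->] ->; exists (inl u); first exact: map_f.
by rewrite imsetU1 imset_set1 (next_map inl_inj).
Qed.

(** An attached leaf on a cycle would have [x] both as its next and as its previous vertex, which
    length above 2 excludes. *)
Lemma cycle_attach (c : seq A) : 2 < size c -> ucycle adj c ->
  exists2 c0 : seq G, ucycle adj c0 & c = map inl c0.
Proof.
move=> sc /andP[cc uc].
have core v : v \in c -> exists u, v = inl u.
  case: v => [u _|i ic]; first by exists u.
  have /negP[] := next_neq_prev uc sc ic.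
  have := next_cycle cc ic; have := prev_cycle cc ic.
  by case: (next c _) (prev c _) => [a|j] [b|k] //= /eqP -> /eqP ->.
have [c0 def_c] : exists c0, c = map inl c0.
  elim: (c) core => [|v s IH] core; first by exists [::].
  have [u ->] := core v (mem_head v s).
  have [w ws|c0 ->] := IH; last by exists (u :: c0).
  by apply: core; rewrite inE ws orbT.
exists c0 => //; rewrite /ucycle.
have inl_inj : injective (@inl G 'I_m) by move=> ? ? [].
move: uc cc; rewrite def_c (map_inj_uniq inl_inj) => ->.
by rewrite (cycle_map (e' := @adj A)) andbT.
Qed.

Lemma attach_unicyclic : unicyclic G -> unicyclic A.
Proof.
case=> conG [E [[c [sc /andP[cc uc] def_E]] uniqE]].
have con_inl a b : connect (@adj A) (inl a) (inl b).
  have /connectP[p pp ->] := conG a b.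
  elim: p a pp => //= d p IH a /andP[ad pp].
  by apply: connect_trans (IH d pp); apply: connect1.
have con_x u : connect (@adj A) u (inl x).
  by case: u => [a|i] //; apply: connect1 => /=.
have csym := sym_connect_sym (@adj_sym A).
split=> [u v|].
  by apply: connect_trans (con_x u) _; rewrite csym.
have inl_inj : injective (@inl G 'I_m) by move=> ? ? [].
exists (cycle_edges (map inl c : seq A)); split.
  exists (map inl c); split; rewrite ?size_map //.
  rewrite /ucycle (map_inj_uniq inl_inj) uc andbT.
  by rewrite (cycle_map (e' := @adj A)).
move=> _ [c' [sc' ucc' ->]]; have [c0 ucc0 def_c'] := cycle_attach sc' ucc'.
have [_ uc0] := andP ucc0; rewrite def_c' !cycle_edges_attach // -def_E.
rewrite (uniqE (cycle_edges c0)) //; exists c0.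
by rewrite -(size_map (@inl G 'I_m)) -def_c'.
Qed.

Lemma order_attach : order_of A = order_of G + m.
Proof. by rewrite /order_of card_sum card_ord. Qed.

Lemma deg_attach_inl (a : G) : deg (inl a : A) = deg a + (a == x) * m.
Proof.
rewrite /deg -!sum1dep_card big_sumType /=; congr (_ + _).
by case: eqP => _; rewrite ?big_pred0_eq // sum_nat_const card_ord mul1n muln1.
Qed.

Lemma deg_attach_inr (i : 'I_m) : deg (inr i : A) = 1.
Proof.
by rewrite /deg -sum1dep_card big_sumType /= big_pred0_eq big_pred1_eq.
Qed.

(** Only [x] changes degree, and each new leaf adds 1. The old cube of [deg x] stands on the left to
    avoid truncated subtraction. *)
Lemma F_index_attach :
  F_index A + deg x ^ 3 = F_index G + (deg x + m) ^ 3 + m.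
Proof.
rewrite /F_index big_sumType /=.
under [X in _ + X + _]eq_bigr => i _ do rewrite deg_attach_inr.
under eq_bigr => a _ do rewrite deg_attach_inl.
rewrite sum_nat_const card_ord muln1.
rewrite (bigD1 x) // [X in _ = X + _ + _](bigD1 x) //= eqxx mul1n.
under eq_bigr => a ax do rewrite (negPf ax) mul0n addn0.
lia.
Qed.
End Attach.

Lemma deg_cycle_graph k (v : cycle_graph k) : 2 < k -> deg v = 2.
Proof.
case: k v => [|[|[|k]]] // v _.
rewrite /deg; have -> : [set u | adj v u] = [set (v + 1)%R; (v - 1)%R].
  apply/setP => u; rewrite !inE /= /cycle_adj; congr (_ || _).
  by rewrite -GRing.subr_eq eq_sym.
(* The two neighbours differ because 2 is nonzero modulo [k.+3]. *)
rewrite cards2 (inj_eq (GRing.addrI v)) -GRing.subr_eq0 GRing.opprK.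
by have -> : (1 + 1 != 0 :> 'Z_k.+3)%R by [].
Qed.

Lemma F_cycle_graph k : 2 < k -> F_index (cycle_graph k) = k * 8.
Proof.
move=> k2; rewrite /F_index.
under eq_bigr => v _ do rewrite deg_cycle_graph //.
by rewrite sum_nat_const; case: k k2 => [|[|k]] // _; rewrite card_ord.
Qed.

Lemma order_cycle_graph k : 1 < k -> order_of (cycle_graph k) = k.
Proof. by case: k => [|[|k]] // _; rewrite /order_of card_ord. Qed.

Lemma cycle_graph_unicyclic k (c : seq (cycle_graph k)) :
  2 < k -> size c = k -> ucycle adj c -> unicyclic (cycle_graph k).
Proof.
move=> k2 sc ucc; have [cc uc] := andP ucc.
have all_c v : v \in c.
  by have /subset_cardP/(_ (subset_predT _)) -> : #|c| = #|cycle_graph k|;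
    rewrite // (card_uniqP uc) sc -[RHS]/(order_of _) order_cycle_graph // ltnW.
apply: (regular2_unicyclic (c := c)) => //; last by rewrite sc.
- by move=> u v; apply: (connect_cycle cc).
- by move=> v; apply: deg_cycle_graph.
Qed.

Lemma C3_unicyclic : unicyclic (cycle_graph 3).
Proof. exact: (@cycle_graph_unicyclic 3 [:: 0; 1; 2%:R]%R). Qed.

Lemma C4_unicyclic : unicyclic (cycle_graph 4).
Proof. exact: (@cycle_graph_unicyclic 4 [:: 0; 1; 2%:R; 3%:R]%R). Qed.

(** * Recognising the extremal graphs *)

(** Non-adjacency is preserved too, so an embedding between graphs of equal order is an
    isomorphism. *)
Definition embedding (H G : sgraph) (f : H -> G) : Prop :=
  injective f /\ forall a b, adj (f a) (f b) = adj a b.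

Lemma embedding_isomorphic (H G : sgraph) (f : H -> G) :
  embedding f -> order_of H = order_of G -> isomorphic G H.
Proof.
case=> injf adjf oHG.
have [g fK gK] : bijective f.
  by apply: inj_card_bij => //; rewrite -/(order_of G) -oHG.
by exists g; split=> [|a b]; [exists f | rewrite -adjf !gK].
Qed.

Definition extend (H G : sgraph) (x : H) m (f : H -> G) (g : 'I_m -> G)
  (u : attach x m) : G :=
  match u with inl a => f a | inr i => g i end.

Lemma embedding_extend (H G : sgraph) (x : H) m (f : H -> G) (g : 'I_m -> G) :
  embedding f -> injective g -> (forall i a, g i != f a) ->
  (forall i a, adj (g i) (f a) = (a == x)) ->
  (forall i j, adj (g i) (g j) = false) ->
  embedding (extend (x := x) f g).
Proof.
case=> injf adjf injg gf adjg ggn; split=> [[a|i] [b|j]|[a|i] [b|j]] //=.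
- by move/injf->.
- by move=> fg; have := gf j a; rewrite fg eqxx.
- by move=> fg; have := gf i b; rewrite fg eqxx.
- by move/injg->.
- by rewrite adj_sym.
Qed.

Lemma enum_set_fun (T : finType) (S : {set T}) m : #|S| = m ->
  exists g : 'I_m -> T, [/\ injective g, forall i, g i \in S
    & forall s, s \in S -> exists i, g i = s].
Proof.
move=> <-; exists enum_val; split; [exact: enum_val_inj|exact: enum_valP|].
by move=> s sS; exists (enum_rank_in sS s); rewrite enum_rankK_in.
Qed.

(** A transposition of the indices moves [s0] to position [i0]. This serves to hit the leaf
    [G31_leaf], whose index is unspecified. *)
Lemma enum_set_fun_at (T : finType) (S : {set T}) m (i0 : 'I_m) s0 :
  #|S| = m -> s0 \in S ->
  exists g : 'I_m -> T, [/\ injective g, forall i, g i \in S & g i0 = s0].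
Proof.
move=> Sm /[dup] s0S; have [g [injg gS sur]] := enum_set_fun Sm.
case/sur => j gj; exists (fun i => g (tperm i0 j i)); split=> //.
  by move=> a b /injg/perm_inj.
by rewrite tpermL.
Qed.

(** Extends a partial copy of a target graph by one round of leaves: [S] collects vertices of [G]
    outside the copy whose only neighbour is [f x]. *)
Lemma embedding_leaves (H G : sgraph) (x : H) m (f : H -> G) (S : {set G}) :
  embedding f -> #|S| = m ->
  (forall v, v \in S -> forall a, v != f a) ->
  (forall v, v \in S -> forall u, adj v u = (u == f x)) ->
  exists f' : attach x m -> G,
    [/\ embedding f', forall a, f' (inl a) = f a & forall i, f' (inr i) \in S].
Proof.
move=> embf Sm Sf adjS; have [g [injg gS _]] := enum_set_fun Sm.
exists (extend (x := x) f g); split=> //; apply: embedding_extend => //.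
- by move=> i a; apply: Sf.
- by move=> i a; rewrite adjS // (inj_eq (proj1 embf)).
- by move=> i j; rewrite adjS //; apply/negbTE/Sf.
Qed.

Lemma Z3_ind (P : 'Z_3 -> Prop) :
  P 0%R -> P 1%R -> P (2%:R)%R -> forall i, P i.
Proof.
move=> P0 P1 P2 i.
by case: i => -[|[|[|//]]] lt_i;
  [move: P0|move: P1|move: P2]; congr P; apply: val_inj.
Qed.

Lemma Z4_ind (P : 'Z_4 -> Prop) :
  P 0%R -> P 1%R -> P (2%:R)%R -> P (3%:R)%R -> forall i, P i.
Proof.
move=> P0 P1 P2 P3 i.
by case: i => -[|[|[|[|//]]]] lt_i;
  [move: P0|move: P1|move: P2|move: P3]; congr P; apply: val_inj.
Qed.

Lemma triangle_embedding (G : sgraph) (x y z : G) :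
  adj x y -> adj y z -> adj x z ->
  exists f : cycle_graph 3 -> G,
    [/\ embedding f, f 0%R = x, f 1%R = y & f (2%:R)%R = z].
Proof.
move=> xy yz xz.
exists (fun i : cycle_graph 3 => nth x [:: x; y; z] (i : 'Z_3)); split=> //.
have neq (u v : G) : adj u v -> u != v.
  by apply: contraTneq => ->; rewrite adj_irr.
have [[nxy nyz] nxz] := (neq _ _ xy, neq _ _ yz, neq _ _ xz).
split.
  by move=> i j /eqP; rewrite nth_uniq // /= ?inE ?negb_or ?nxy ?nxz ?nyz //;
    move/eqP/val_inj.
by elim/Z3_ind=> j; elim/Z3_ind: j; rewrite /= ?adj_irr // adj_sym.
Qed.

Lemma square_embedding (G : sgraph) (x y z w : G) :
  adj x y -> adj y z -> adj z w -> adj w x -> ~~ adj x z -> ~~ adj y w ->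
  x != z -> y != w ->
  exists f : cycle_graph 4 -> G,
    [/\ embedding f, f 0%R = x, f 1%R = y, f (2%:R)%R = z & f (3%:R)%R = w].
Proof.
move=> xy yz zw wx /negbTE nxz /negbTE nyw xz yw.
exists (fun i : cycle_graph 4 => nth x [:: x; y; z; w] (i : 'Z_4)); split=> //.
have neq (u v : G) : adj u v -> u != v.
  by apply: contraTneq => ->; rewrite adj_irr.
have := (neq _ _ xy, neq _ _ yz, neq _ _ zw, neq _ _ wx).
case=> [[[nxy nyz] nzw]]; rewrite eq_sym => nxw; split.
  by move=> i j /eqP; rewrite nth_uniq //
     /= ?inE ?negb_or ?nxy ?nxw ?nyz ?nzw ?xz ?yw //; move/eqP/val_inj.
by elim/Z4_ind=> j; elim/Z4_ind: j; rewrite /= ?adj_irr // adj_sym.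
Qed.

(** * Triangles with leaves attached *)

Definition leaves_at (G : sgraph) (x : G) : {set G} :=
  [set u | adj x u & deg u == 1].

Section Sun.
Variables (G : sgraph) (x y z : G).
Hypotheses (uniG : unicyclic G) (xy : adj x y) (yz : adj y z) (xz : adj x z).
Hypothesis leaf : forall v, v \notin [set x; y; z] -> deg v = 1.

Let neq (u v : G) : adj u v -> u != v.
Proof. by apply: contraTneq => ->; rewrite adj_irr. Qed.

Let core_deg v : v \in [set x; y; z] -> 1 < deg v.
Proof.
rewrite !inE -orbA => /or3P[] /eqP->.
- exact: deg_gt1 xy xz (neq yz).
- by apply: deg_gt1 yz _ _; [rewrite adj_sym; exact: xy | rewrite eq_sym neq].
- by apply: (deg_gt1 (u := x) (w := y)); rewrite 1?adj_sym // neq.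
Qed.

(** The neighbours of [a] outside the triangle are leaves, while [b] and [c] are not. Stating it for
    a permuted triple lets one proof serve all three corners. *)
Lemma deg_sun a b c : [set a; b; c] = [set x; y; z] -> adj a b -> adj a c ->
  b != c -> deg a = 2 + #|leaves_at a|.
Proof.
move=> abc ab ac bc; have <- : #|[set b; c]| = 2 by rewrite cards2 bc.
have nleaf v : v \in [set b; c] -> deg v == 1 = false.
  move=> bcv; apply: gtn_eqF; apply: core_deg; rewrite -abc.
  by move: bcv; rewrite !inE -orbA => ->; rewrite orbT.
rewrite /deg -cardsUI; have -> : [set b; c] :&: leaves_at a = set0.
  apply/setP => v; rewrite in_setI in_set0 [v \in leaves_at a]inE.
  by case: (boolP (v \in [set b; c])) => // /nleaf ->; rewrite andbF.
rewrite cards0 addn0; apply: eq_card => v; rewrite in_setU !inE.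
have [av|nav] := boolP (adj a v); last first.
  by rewrite orbF; apply/esym/norP; split; apply: contraNneq nav => ->.
have [vbc|] := boolP (v \in [set a; b; c]).
  move: vbc; rewrite !inE -orbA => /predU1P[va|->//].
  by rewrite va adj_irr in av.
by rewrite abc => /leaf ->; rewrite orbT.
Qed.

Lemma degs_sun : [/\ deg x = 2 + #|leaves_at x|, deg y = 2 + #|leaves_at y|
  & deg z = 2 + #|leaves_at z|].
Proof.
have [yx zx zy] : [/\ adj y x, adj z x & adj z y].
  by split; rewrite adj_sym.
split.
- exact: (deg_sun (erefl _) xy xz (neq yz)).
- apply: (deg_sun _ yx yz (neq xz)).
  by apply/setP => v; rewrite !inE; do !case: eqP.
- apply: (deg_sun _ zx zy (neq xy)).
  by apply/setP => v; rewrite !inE; do !case: eqP.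
Qed.

(** The degrees sum to twice the order, and the vertices outside the triangle contribute the order
    minus 3. The leaves are thus counted without locating each of them. *)
Lemma order_sun :
  order_of G = 3 + #|leaves_at x| + #|leaves_at y| + #|leaves_at z|.
Proof.
have := unicyclic_sum_deg uniG; have [dx dy dz] := degs_sun.
rewrite (bigID (mem [set x; y; z])) /=.
rewrite [X in X + _](_ : _ = deg x + deg y + deg z); last first.
  rewrite -setUA !big_setU1 ?inE ?negb_or ?neq //= ?big_set1 ?addnA //.
rewrite [X in _ + X](_ : _ = order_of G - 3); last first.
  rewrite (eq_bigr (fun=> 1)) => [|v /leaf//].
  rewrite sum1dep_card -[LHS]/(#|~: [set x; y; z]|) cardsCs setCK.
  by rewrite -setUA !cardsU1 !inE ?negb_or ?neq ?cards1.
have : 2 < order_of G.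
  have <- : #|[set x; y; z]| = 3.
    by rewrite -setUA !cardsU1 !inE ?negb_or ?neq ?cards1.
  exact: max_card.
lia.
Qed.

(** The copy grows corner by corner: first the leaves at [x], then in the next two lemmas those at
    [y] and [z]. Comparing orders later shows that no vertex is left out. *)
Lemma sun_embedding1 :
  exists f : attach (0%R : cycle_graph 3) #|leaves_at x| -> G,
  [/\ embedding f, [/\ f (inl 0%R) = x, f (inl 1%R) = y & f (inl (2%:R)%R) = z]
    & forall i, f (inr i) \in leaves_at x].
Proof.
have [f [embf fx fy fz]] := triangle_embedding xy yz xz.
have [||f' [embf' f'l f'r]] :=
    embedding_leaves (x := 0%R : cycle_graph 3) embf (erefl #|leaves_at x|).
- move=> v; rewrite inE => /andP[_ /eqP v1] a; apply: contra_eq_neq v1 => ->.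
  rewrite gtn_eqF // core_deg // !inE.
  by elim/Z3_ind: a; rewrite ?fx ?fy ?fz eqxx ?orbT.
- move=> v; rewrite inE fx => /andP[xv /eqP v1].
  by apply: leaf_adj v1 _; rewrite adj_sym.
by exists f'; split=> //; rewrite !f'l.
Qed.

Lemma sun_embedding2 : exists f : attach (inl 1%R :
    attach (0%R : cycle_graph 3) #|leaves_at x|) #|leaves_at y| -> G,
  [/\ embedding f,
    [/\ f (inl (inl 0%R)) = x, f (inl (inl 1%R)) = y
      & f (inl (inl (2%:R)%R)) = z],
    forall i, f (inl (inr i)) \in leaves_at x &
    forall i, f (inr i) \in leaves_at y].
Proof.
have [f [embf [fx fy fz] fL]] := sun_embedding1.
have [||f' [embf' f'l f'r]] := embedding_leaves (x := inl 1%R :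
    attach (0%R : cycle_graph 3) #|leaves_at x|) embf (erefl #|leaves_at y|).
- move=> v; rewrite inE => /andP[yv /eqP v1] [a|i].
    apply: contra_eq_neq v1 => ->; rewrite gtn_eqF // core_deg // !inE.
    by elim/Z3_ind: a; rewrite ?fx ?fy ?fz eqxx ?orbT.
  (* A leaf at both [x] and [y] would have two distinct neighbours. *)
  apply: contraTneq (fL i) => <-; rewrite inE negb_and adj_sym.
  rewrite (leaf_adj v1 (u := y)); last by rewrite adj_sym.
  by rewrite neq.
- move=> v; rewrite inE fy => /andP[yv /eqP v1].
  by apply: leaf_adj v1 _; rewrite adj_sym.
by exists f'; split=> // [|i]; rewrite !f'l.
Qed.

Lemma sun_embedding3 : exists f : attach (inl (inl (2%:R)%R) : attach (inl 1%R :
    attach (0%R : cycle_graph 3) #|leaves_at x|) #|leaves_at y|)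
    #|leaves_at z| -> G, embedding f.
Proof.
have [f [embf [fx fy fz] fL fL']] := sun_embedding2.
have [||f' [embf' _ _]] := embedding_leaves (x := inl (inl (2%:R)%R) :
    attach (inl 1%R :
      attach (0%R : cycle_graph 3) #|leaves_at x|) #|leaves_at y|)
    embf (erefl #|leaves_at z|).
- move=> v; rewrite inE => /andP[zv /eqP v1] [[a|i]|i].
  + apply: contra_eq_neq v1 => ->; rewrite gtn_eqF // core_deg // !inE.
    by elim/Z3_ind: a; rewrite ?fx ?fy ?fz eqxx ?orbT.
  + apply: contraTneq (fL i) => <-; rewrite inE negb_and adj_sym.
    rewrite (leaf_adj v1 (u := z)); last by rewrite adj_sym.
    by rewrite neq.
  + apply: contraTneq (fL' i) => <-; rewrite inE negb_and adj_sym.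
    rewrite (leaf_adj v1 (u := z)); last by rewrite adj_sym.
    by rewrite neq.
- move=> v; rewrite inE fz => /andP[zv /eqP v1].
  by apply: leaf_adj v1 _; rewrite adj_sym.
by exists f'.
Qed.

Let n := order_of G.

Lemma sun_Gk1 : deg y = 2 -> deg z = 2 -> isomorphic G (Gk1 3 n).
Proof.
have [_ -> ->] := degs_sun; have := order_sun; rewrite -/n => nE y2 z2.
have [f [embf _ _]] := sun_embedding1; rewrite /Gk1.
have -> : n - 3 = #|leaves_at x| by lia.
apply: embedding_isomorphic embf _.
by rewrite !order_attach order_cycle_graph // -/n; lia.
Qed.

Lemma sun_Gk2 : deg y = 3 -> deg z = 2 -> isomorphic G (Gk2 3 n).
Proof.
have [_ -> ->] := degs_sun; have := order_sun; rewrite -/n => nE y2 z2.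
have [f [embf _ _ _]] := sun_embedding2; rewrite /Gk2.
move: f embf; have -> : #|leaves_at y| = 1 by lia.
have -> : #|leaves_at x| = n - 3 - 1 by lia.
move=> f embf; apply: embedding_isomorphic embf _.
by rewrite !order_attach order_cycle_graph // -/n; lia.
Qed.

Lemma sun_G33 : deg y = 4 -> deg z = 2 -> isomorphic G (G33 n).
Proof.
have [_ -> ->] := degs_sun; have := order_sun; rewrite -/n => nE y2 z2.
have [f [embf _ _ _]] := sun_embedding2; rewrite /G33.
move: f embf; have -> : #|leaves_at y| = 2 by lia.
have -> : #|leaves_at x| = n - 5 by lia.
move=> f embf; apply: embedding_isomorphic embf _.
by rewrite !order_attach order_cycle_graph // -/n; lia.
Qed.

Lemma sun_G34 : deg y = 3 -> deg z = 3 -> isomorphic G (G34 n).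
Proof.
have [_ -> ->] := degs_sun; have := order_sun; rewrite -/n => nE y2 z2.
have [f embf] := sun_embedding3; move: f embf.
have -> : #|leaves_at z| = 1 by lia.
have -> : #|leaves_at y| = 1 by lia.
have -> : #|leaves_at x| = n - 5 by lia.
move=> f embf; apply: embedding_isomorphic embf _.
by rewrite !order_attach order_cycle_graph // -/n; lia.
Qed.
End Sun.

(** * Graphs with a single vertex not adjacent to the centre *)

Lemma deg2_nbr (G : sgraph) (v a b : G) : deg v = 2 -> adj v a -> adj v b ->
  a != b -> forall w, adj v w = (w == a) || (w == b).
Proof.
move=> v2 va vb ab w.
have /eqP/setP/(_ w) : [set a; b] == [set w | adj v w].
  rewrite eqEcard [X in X <= _]v2 cards2 ab andbT.
  by apply/subsetP => u /set2P[] ->; rewrite inE.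
by rewrite !inE.
Qed.

Lemma deg2_other (G : sgraph) (v a : G) : deg v = 2 ->
  exists2 b, adj v b & b != a.
Proof.
move=> v2; have /card_gt1P[b [c [vb vc bc]]] : 1 < #|[set u | adj v u]|.
  by rewrite [X in _ < X]v2.
rewrite !inE in vb vc; have [ba|ba] := eqVneq b a; last by exists b.
by exists c => //; rewrite -ba eq_sym.
Qed.

(** Cycle vertices have degree at least 2, so the picked vertex of degree 1 is an attached leaf; one
    exists since [3 < n]. *)
Lemma G31_leafE n : 3 < n -> exists i, G31_leaf n = inr i.
Proof.
move=> n4; rewrite /G31_leaf; case: pickP => [[a|i] /= |none].
- rewrite deg_attach_inl deg_cycle_graph //.
- by exists i.
have i : 'I_(n - 3) by apply: (@Ordinal _ 0); rewrite subn_gt0.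
by have := none (inr i); rewrite deg_attach_inr.
Qed.

(* Non-leaves x, y, z, w with y, z, w of degree 2, and v the only vertex other
   than x that is not adjacent to x. *)
Section FourCore.
Variables (G : sgraph) (x y z w v : G).
Hypotheses (xyzw : uniq [:: x; y; z; w]).
Hypotheses (y2 : deg y = 2) (z2 : deg z = 2) (w2 : deg w = 2).
Hypothesis leaf : forall u, u \notin [:: x; y; z; w] -> deg u = 1.
Hypotheses (vx : v != x) (nxv : ~~ adj x v).
Hypothesis adjx : forall u, u != x -> u != v -> adj x u.

Let n := order_of G.

Let xyzw_neq : [/\ y != x, z != x, w != x & [/\ z != y, w != y & w != z]].
Proof.
move: xyzw; rewrite /= !inE !negb_or.
move=> /and3P[/and3P[? ? ?] /andP[? ?] /andP[? _]].
by do !split; rewrite eq_sym.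
Qed.

(** Every leaf is adjacent to [x] only, so the two neighbours of [y] are [z] and [w]. These have
    degree 2, which makes [x], [z], [y], [w] a square without diagonals; all other vertices hang at
    [x]. *)
Lemma four_core_Gk1 : v = y -> isomorphic G (Gk1 4 n).
Proof.
have [yx zx wx [zy wy wz]] := xyzw_neq.
move=> vy; have nxy : ~~ adj x y by rewrite -vy.
have xz : adj x z by rewrite adjx // vy.
have xw : adj x w by rewrite adjx // vy.
have nbr_y u : adj y u = (u == z) || (u == w).
  have /eqP/setP/(_ u) : [set u | adj y u] == [set z; w].
    rewrite eqEcard [X in _ <= X]y2 cards2 [z == w]eq_sym wz andbT.
    apply/subsetP => s; rewrite !inE => ys.
    have [] := boolP (s \in [:: x; y; z; w]).
      rewrite !inE => /or4P[] /eqP sE; rewrite sE ?eqxx ?orbT //.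
        by rewrite sE adj_sym (negPf nxy) in ys.
      by rewrite sE adj_irr in ys.
    move=> sl; have s1 := leaf sl; move: sl.
    rewrite !inE !negb_or => /and4P[sx sy _ _].
    have sx' : adj s x by rewrite adj_sym adjx // vy.
    by move: ys; rewrite adj_sym (leaf_adj s1 sx') (negPf yx).
  by rewrite !inE.
have yz : adj y z by rewrite nbr_y eqxx.
have yw : adj y w by rewrite nbr_y eqxx orbT.
have nzw : ~~ adj z w.
  rewrite (deg2_nbr z2 (a := x) (b := y)) 1?adj_sym //; last by rewrite eq_sym.
  by rewrite negb_or wx wy.
have [||||||||f [embf f0 f1 f2 f3]] :=
  square_embedding (x := x) (y := z) (z := y) (w := w); rewrite // 1?eq_sym //.
- by rewrite adj_sym.
- by rewrite adj_sym.
pose S := [set u | u \notin [:: x; y; z; w]].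
have cardS : #|S| = n - 4.
  have -> : S = ~: [set u in [:: x; y; z; w]] by apply/setP => u; rewrite !inE.
  by rewrite cardsCs setCK cardsE (card_uniqP xyzw).
have [||f' [embf' _ _]] :=
  embedding_leaves (x := 0%R : cycle_graph 4) embf cardS.
- move=> u uS a; move: uS; rewrite !inE !negb_or => /and4P[? ? ? ?].
  by elim/Z4_ind: a; rewrite ?f0 ?f1 ?f2 ?f3.
- move=> u; rewrite inE f0 => uS; apply: (leaf_adj (leaf uS)).
  move: uS; rewrite !inE !negb_or => /and4P[? ? _ _].
  by rewrite adj_sym adjx // vy.
apply: embedding_isomorphic embf' _.
rewrite order_attach order_cycle_graph // -/n subnKC //.
by rewrite -[4]/(size [:: x; y; z; w]) -(card_uniqP xyzw) max_card.
Qed.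

(** The neighbours of [y] are [x] and [v]. The neighbour of [z] other than [x] can then only be [w],
    so [x], [z], [w] form the triangle. *)
Lemma four_core_G31' : 4 < n -> deg v = 1 -> adj v y -> isomorphic G (G31' n).
Proof.
have [yx zx wx [zy wy wz]] := xyzw_neq.
move=> n5 v1 vy.
have deg1_neq u : deg u = 2 -> u != v.
  by move=> u2; apply: contra_eq_neq u2 => ->; rewrite v1.
have [yv zv wv] := And3 (deg1_neq _ y2) (deg1_neq _ z2) (deg1_neq _ w2).
have nbr_v := leaf_adj v1 vy.
have nbr_y u : adj y u = (u == x) || (u == v).
  by apply: deg2_nbr; rewrite 1?adj_sym // 1?eq_sym // adjx.
have leaf_x u : u \notin [:: x; y; z; w] -> u != v ->
    forall s, adj u s = (s == x).
  move=> ul uv; apply: (leaf_adj (leaf ul)); rewrite adj_sym adjx //.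
  by move: ul; rewrite inE negb_or => /andP[].
have zw : adj z w.
  have [u zu ux] := deg2_other x z2.
  have uv : u != v.
    by apply: contraTneq zu => ->; rewrite adj_sym nbr_v.
  have [] := boolP (u \in [:: x; y; z; w]).
    rewrite !inE (negPf ux) /= => /or3P[] /eqP uE; last by rewrite -uE.
      by move: zu; rewrite uE adj_sym nbr_y (negPf zx) (negPf zv).
    by rewrite uE adj_irr in zu.
  by move=> /leaf_x/(_ uv z); rewrite adj_sym zu (negPf zx).
have xz : adj x z by rewrite adjx.
have xw : adj x w by rewrite adjx.
have nbr_z u : adj z u = (u == x) || (u == w).
  by apply: deg2_nbr; rewrite // 1?adj_sym // eq_sym.
have nbr_w u : adj w u = (u == x) || (u == z).
  by apply: deg2_nbr; rewrite 1?adj_sym // eq_sym.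
have [f [embf f0 f1 f2]] := triangle_embedding xz zw xw.
(* [y] belongs to [S]: once [v] is left out, it is a leaf at [x] in the copy of [Gk1 3 (n - 1)].
   Below, [gi0] makes it the leaf that receives [v]. *)
pose S := [set u | u \notin [:: x; z; w; v]].
have cardS : #|S| = n - 1 - 3.
  have -> : S = ~: [set u in [:: x; z; w; v]] by apply/setP => u; rewrite !inE.
  rewrite cardsCs setCK cardsE (card_uniqP _) -?subnDA //=.
  by rewrite !inE !negb_or zv wv ![x == _]eq_sym zx wx vx [z == w]eq_sym wz.
have yS : y \in S by rewrite !inE !negb_or yx yv ![y == _]eq_sym zy wy.
have n4 : 3 < n - 1 by rewrite ltn_subRL.
have [i0 leafE] := G31_leafE n4.
have [g [injg gS gi0]] := enum_set_fun_at i0 cardS yS.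
have embg : embedding (extend (x := 0%R : cycle_graph 3) f g).
  apply: embedding_extend => // [i a|i a|i j];
    move: (gS i); rewrite !inE !negb_or.
  - by move=> /and4P[? ? ? ?]; elim/Z3_ind: a; rewrite ?f0 ?f1 ?f2.
  - move=> /and4P[sx sz sw sv]; elim/Z3_ind: a; rewrite ?f0 ?f1 ?f2.
    + by rewrite eqxx adj_sym adjx.
    + by rewrite adj_sym nbr_z (negPf sx) (negPf sw).
    + by rewrite adj_sym nbr_w (negPf sx) (negPf sz).
  - move=> /and4P[sx sz sw sv]; move: (gS j); rewrite !inE !negb_or.
    move=> /and4P[tx _ _ tv]; have [->|sy] := eqVneq (g i) y.
      by rewrite nbr_y (negPf tx) (negPf tv).
    by rewrite leaf_x ?(negPf tx) // !inE !negb_or sx sy sz sw.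
have [||f' [embf' _ _]] :=
  embedding_leaves (x := G31_leaf (n - 1)) embg (cards1 v).
- move=> u /set1P-> [a|i] /=.
    by elim/Z3_ind: a; rewrite ?f0 ?f1 ?f2 // eq_sym.
  by apply: contraTneq (gS i) => <-; rewrite !inE eqxx !orbT.
- by move=> u /set1P->; rewrite leafE /= gi0.
apply: embedding_isomorphic embf' _.
rewrite order_attach order_attach order_cycle_graph //.
by rewrite (subnKC (ltnW n4)) subnK // (leq_trans _ n5).
Qed.
End FourCore.

(** The degree of [x] leaves it a single non-neighbour [v]. If [v] is a leaf, its neighbour has
    degree above 1 and is not [x], so it is [y], [z] or [w]. *)
Lemma four_core (G : sgraph) (x y z w : G) : unicyclic G ->
  uniq [:: x; y; z; w] -> deg y = 2 -> deg z = 2 -> deg w = 2 ->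
  deg x + 2 = order_of G -> 4 < order_of G ->
  (forall u, u \notin [:: x; y; z; w] -> deg u = 1) ->
  isomorphic G (G31' (order_of G)) \/ isomorphic G (Gk1 4 (order_of G)).
Proof.
move=> uniG xyzw y2 z2 w2 dx n5 leaf.
have [v [vx nxv adjx]] : exists v, [/\ v != x, ~~ adj x v
    & forall u, u != x -> u != v -> adj x u].
  pose N := ~: [set u | adj x u].
  have : #|N :\ x| == 1.
    have xN : x \in N by rewrite !inE adj_irr.
    have N2 : #|N| = 2.
      by rewrite cardsCs setCK -/(order_of G) -/(deg x) -dx addKn.
    by move: N2; rewrite (cardsD1 x N) xN => /eqP.
  case/cards1P => v /setP Nv; exists v.
  have := Nv v; rewrite !inE eqxx => /andP[vx nxv]; split=> // u ux uv.
  by have := Nv u; rewrite !inE ux (negPf uv) => /negbFE.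
(* By symmetry, [y'] is the one of [y], [z], [w] that equals [v] or carries it as a leaf. *)
have special y' z' w' : perm_eq [:: x; y'; z'; w'] [:: x; y; z; w] ->
    deg y' = 2 -> deg z' = 2 -> deg w' = 2 -> v = y' \/ deg v = 1 /\ adj v y' ->
    isomorphic G (G31' (order_of G)) \/ isomorphic G (Gk1 4 (order_of G)).
  move=> p y'2 z'2 w'2.
  have uniq' : uniq [:: x; y'; z'; w'] by rewrite (perm_uniq p).
  have leaf' u : u \notin [:: x; y'; z'; w'] -> deg u = 1.
    by rewrite (perm_mem p); apply: leaf.
  case=> [vy|[v1 vy]]; [right|left].
    exact: (four_core_Gk1 uniq' y'2 z'2 leaf' nxv adjx vy).
  exact: (four_core_G31' uniq' y'2 z'2 w'2 leaf' vx adjx n5 v1 vy).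
have special_y := special y z w (perm_refl _) y2 z2 w2.
have perm_z : perm_eq [:: x; z; y; w] [:: x; y; z; w].
  by rewrite perm_cons (perm_catCA [:: z] [:: y] [:: w]).
have special_z := special z y w perm_z z2 y2 w2.
have perm_w : perm_eq [:: x; w; z; y] [:: x; y; z; w].
  by rewrite perm_cons (perm_rev [:: y; z; w]).
have special_w := special w z y perm_w w2 z2 y2.
have [vc|/leaf v1] := boolP (v \in [:: x; y; z; w]).
  move: vc; rewrite !inE (negPf vx) /= => /or3P[] /eqP vE.
  - by apply: special_y; left.
  - by apply: special_z; left.
  - by apply: special_w; left.
have /card_gt0P[u] : 0 < #|[set u | adj v u]| by rewrite [X in _ < X]v1.
rewrite inE => vu; have u2 := unicyclic_leaf_nbr uniG v1 vu.
have [uc|/leaf u1] := boolP (u \in [:: x; y; z; w]); last by rewrite u1 in u2.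
move: uc; rewrite !inE => /or4P[] /eqP uE; rewrite uE in vu.
- by rewrite adj_sym (negPf nxv) in vu.
- by apply: special_y; right.
- by apply: special_z; right.
- by apply: special_w; right.
Qed.

(** * The cycle and the largest degrees *)

Lemma cycle_in_triple (G : sgraph) (c : seq G) (x y z : G) :
  2 < size c -> ucycle adj c -> uniq [:: x; y; z] ->
  {subset c <= [:: x; y; z]} -> [/\ adj x y, adj y z & adj x z].
Proof.
move=> sc /andP[cc uc] uxyz sub.
have [sz mem_c] := uniq_min_size uc sub sc.
have mem_xyz u : u \in [:: x; y; z] -> u \in c by rewrite mem_c.
case: c sz cc {sc uc sub mem_c} mem_xyz => [|p [|q [|r []]]] //= _.
case/and4P => pq qr rp _ mem_xyz.
have pair u u' :
    u \in [:: x; y; z] -> u' \in [:: x; y; z] -> u != u' -> adj u u'.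
  move=> /mem_xyz ui /mem_xyz ui'; move: ui ui'.
  rewrite !inE => /or3P[] /eqP-> /or3P[] /eqP->; rewrite ?eqxx // => _;
    by rewrite // adj_sym.
move: uxyz; rewrite /= !inE !negb_or => /and3P[/andP[xy xz] yz _].
by split; apply: pair; rewrite // !inE eqxx ?orbT.
Qed.

(** Convexity: the cube lies below its chord from 1 to [c.+1], whose slope is
    [3 + 3 * c + c * c]. *)
Lemma cube_le c d : 0 < d <= c.+1 -> d ^ 3 <= 1 + d.-1 * (3 + 3 * c + c * c).
Proof.
case: d => // e; rewrite ltnS /= => ec.
have -> : e.+1 ^ 3 = 1 + e * (3 + 3 * e + e * e) by rewrite !expnS expn0; ring.
by rewrite leq_add2l leq_mul // leq_add ?leq_mul // leq_add2l leq_mul.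
Qed.

(** The cycle provides three vertices of degree above 1. Maximising the degree three times, each
    time apart from the vertices already chosen, therefore gives only degrees above 1. *)
Lemma three_largest_degrees (G : sgraph) : unicyclic G ->
  exists x y z : G, [/\ uniq [:: x; y; z], 1 < deg z,
    deg z <= deg y, deg y <= deg x
    & forall v, v \notin [:: x; y; z] -> deg v <= deg z].
Proof.
move=> uniG; have [_ [_ [[c [sc ucc _]] _]]] := uniG.
pose T := [set v : G | 1 < deg v].
have T3 : 2 < #|T|.
  have [_ uc] := andP ucc; apply: (leq_trans sc); rewrite -(card_uniqP uc).
  apply/subset_leq_card/subsetP => v vc.
  by rewrite inE; apply: (cycle_deg_gt1 sc ucc).
have [x0 _] : exists x0, x0 \in T by apply/card_gt0P; apply: leq_trans T3.
case: (arg_maxnP (P := xpredT) (@deg G) (erefl : xpredT x0)) => x _ x_max.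
have T2 : 1 < #|T :\ x|.
  by move: T3; rewrite (cardsD1 x); case: (x \in T) => //; apply: ltnW.
have [y0] : exists y0, y0 \in T :\ x by apply/card_gt0P; apply: ltnW.
rewrite 2!inE => /andP[y0x _].
case: (arg_maxnP (P := fun v => v != x) (@deg G) y0x) => y yx y_max.
have [z0] : exists z0, z0 \in T :\ x :\ y.
  apply/card_gt0P; move: T2.
  by rewrite (cardsD1 y); case: (y \in _) => // /ltnW.
rewrite !inE => /and3P[z0y z0x z0T].
have z0P : (z0 != x) && (z0 != y) by rewrite z0x.
case: (arg_maxnP (P := fun v => (v != x) && (v != y)) (@deg G) z0P).
move=> z /andP[zx zy] z_max; exists x, y, z; split.
- by rewrite /= !inE !negb_or ![x == _]eq_sym yx zx [y == z]eq_sym zy.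
- exact: leq_trans z0T (z_max _ z0P).
- exact: y_max.
- exact: x_max.
- move=> v; rewrite !inE !negb_or => /and3P[vx vy _].
  by apply: z_max; rewrite vx.
Qed.

(** * The F-index *)

(** The bound is the F-index of [G34]: a vertex of degree [order_of G - 3], two of degree 3 giving
    54, and [order_of G - 3] leaves. *)
Lemma unicyclic_F_index_lt (G : sgraph) : unicyclic G -> 5 < order_of G ->
  [\/ isomorphic G (Gk1 3 (order_of G)), isomorphic G (Gk2 3 (order_of G)),
      isomorphic G (G31' (order_of G)) \/ isomorphic G (Gk1 4 (order_of G)) |
      isomorphic G (G33 (order_of G)) \/ isomorphic G (G34 (order_of G))]
  \/ F_index G < (order_of G - 3) ^ 3 + 54 + (order_of G - 3).
Proof.
move=> uniG n6.
have [x [y [z [uxyz z1 zy yx zmax]]]] := three_largest_degrees uniG.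
have n3 : order_of G = order_of G - 3 + 3 by rewrite subnK // (leq_trans _ n6).
pose rest := [pred v : G | v \notin [:: x; y; z]].
pose r := \sum_(v | rest v) (deg v).-1.
have split_sum (F : G -> nat) :
    \sum_v F v = F x + (F y + (F z + \sum_(v | rest v) F v)).
  rewrite (bigID (mem [:: x; y; z])) /= -(big_uniq _ uxyz) /=.
  by rewrite !big_cons big_nil addn0 -!addnA.
have card_rest : \sum_(v | rest v) 1 = order_of G - 3.
  have := split_sum (fun=> 1); rewrite sum1_card /order_of => ->.
  by rewrite !addnA addKn.
have deg_gt0 v := unicyclic_deg_gt0 v uniG.
have rest_deg : \sum_(v | rest v) deg v = (order_of G - 3) + r.
  rewrite -card_rest -big_split /=; apply: eq_bigr => v _.
  by rewrite add1n prednK.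
have sum_deg : deg x + deg y + deg z + r = order_of G + 3.
  have := unicyclic_sum_deg uniG; rewrite split_sum rest_deg.
  move: (order_of G) n3 => n; clear.
  move: (deg x) (deg y) (deg z) r; lia.
have cubes : \sum_(v | rest v) deg v ^ 3 <=
    (order_of G - 3) + r * (3 + 3 * (deg z).-1 + (deg z).-1 * (deg z).-1).
  rewrite -card_rest big_distrl -big_split /=; apply: leq_sum => v vr.
  by apply: cube_le; rewrite deg_gt0 prednK // zmax.
have F_le : F_index G <= deg x ^ 3 + (deg y ^ 3 + (deg z ^ 3 +
    ((order_of G - 3) + r * (3 + 3 * (deg z).-1 + (deg z).-1 * (deg z).-1)))).
  by rewrite /F_index split_sum !leq_add2l.
have rest_leaf : r = 0 -> forall v, v \notin [:: x; y; z] -> deg v = 1.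
  move=> /eqP; rewrite sum_nat_eq0 => /forall_inP r0 v vr.
  by have := r0 v vr; case: (deg v) (deg_gt0 v) => // -[].
have sun : r = 0 -> [/\ adj x y, adj y z, adj x z &
    forall v, v \notin [set x; y; z] -> deg v = 1].
  move=> /rest_leaf leaf; have [_ [_ [[c [sc ucc _]] _]]] := uniG.
  have [|xy yz xz] := cycle_in_triple sc ucc uxyz.
    move=> v vc; have := cycle_deg_gt1 sc ucc vc.
    by apply: contraTT => /leaf ->.
  split=> // v vr; apply: leaf; apply: contra vr.
  by rewrite !inE -orbA.
case dx : (deg x) sum_deg yx F_le => [|a] sum_deg yx F_le.
  by have := deg_gt0 x; rewrite dx.
case dy : (deg y) sum_deg yx zy F_le => [|b] sum_deg yx zy F_le.
  by have := deg_gt0 y; rewrite dy.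
case dz : (deg z) sum_deg z1 zy F_le => [|c] sum_deg z1 zy F_le //.
rewrite /= !ltnS in z1 zy yx sum_deg F_le.
have n_eq : order_of G - 3 = a + b + c + r - 3.
  move: (order_of G) n3 sum_deg; clear; lia.
have [s5|s4] := leqP 5 (b + c + r).
  right; apply: leq_ltn_trans F_le _.
  (* [cube_gap] is used with [m = b + c + r - 5], for which [a + m + 2] is the order minus 3. *)
  have bcr : b + c + r = b + c + r - 5 + 5 by rewrite subnK.
  have := @cube_gap _ a b c r z1 zy yx bcr.
  have -> : a + (b + c + r - 5) + 2 = order_of G - 3.
    by rewrite n_eq; clear -s5; lia.
  by rewrite !addnA ![_ + (order_of G - 3) + _]addnAC ltn_add2r.
have [r0|r0] := posnP r.
  have [xy yz xz leaf] := sun r0.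
  have : (b, c) \in [:: (1, 1); (2, 1); (3, 1); (2, 2)].
    move: r0 s4 zy z1; move: (r) => r'; clear => ->.
    by case: c b => [|[|[|c]]] [|[|[|[|b]]]] //; lia.
  rewrite !inE => /or4P[] /eqP[bE cE]; rewrite bE in dy; rewrite cE in dz.
  - by left; constructor 1; exact: (sun_Gk1 uniG xy yz xz leaf dy dz).
  - by left; constructor 2; exact: (sun_Gk2 uniG xy yz xz leaf dy dz).
  - by left; constructor 4; left; exact: (sun_G33 uniG xy yz xz leaf dy dz).
  - by left; constructor 4; right; exact: (sun_G34 uniG xy yz xz leaf dy dz).
have : (b, c, r) \in [:: (1, 1, 1); (1, 1, 2); (2, 1, 1)].
  move: r0 s4 zy z1; move: (r) => r'; clear.
  by case: c b r' => [|[|c]] [|[|[|b]]] [|[|[|r']]] //; lia.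
rewrite !inE => /or3P[] /eqP[bE cE rE]; last first.
(* The largest degree is that of [G34]. The other terms beyond the count of leaves give 27 + 8 + 7 =
   42 here and 8 + 8 + 14 = 30 in the next case, both below 54. *)
- right; apply: leq_ltn_trans F_le _.
  have -> : a.+1 = order_of G - 3 by rewrite n_eq bE cE rE; clear; lia.
  rewrite bE cE rE; clear; lia.
- right; apply: leq_ltn_trans F_le _.
  have -> : a.+1 = order_of G - 3 by rewrite n_eq bE cE rE; clear; lia.
  rewrite bE cE rE; clear; lia.
have pred_deg (v : G) k : (deg v).-1 = k -> deg v = k.+1.
  by move=> <-; rewrite (prednK (deg_gt0 v)).
(* Exactly one further vertex [w] has degree 2, and the remaining ones are leaves. *)
have /sum_nat_eq1[w [wr /pred_deg w2 w_only]] : r == 1 by rewrite rE.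
left; constructor 3; apply: (@four_core _ x y z w) => //.
- by rewrite -[[:: x; y; z; w]]/(rcons [:: x; y; z] w) rcons_uniq uxyz andbT.
- by rewrite dy bE.
- by rewrite dz cE.
- by apply/eqP; rewrite -(eqn_add2r 3) -sum_deg dx bE cE rE -!addnA.
- exact: ltnW.
move=> u; rewrite -[[:: x; y; z; w]]/(rcons [:: x; y; z] w) mem_rcons.
rewrite inE negb_or.
by case/andP=> uw ur; apply/pred_deg/w_only.
Qed.

(** * Order and F-index of the six graphs *)

Lemma order_Gk1 k n : 1 < k -> k <= n -> order_of (Gk1 k n) = n.
Proof. by move=> k1 kn; rewrite order_attach order_cycle_graph // subnKC. Qed.

Lemma F_index_Gk1 k n : 2 < k ->
  F_index (Gk1 k n) + 8 = k * 8 + (n - k).+2 ^ 3 + (n - k).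
Proof.
move=> k2; have := F_index_attach (0%R : cycle_graph k) (n - k).
by rewrite deg_cycle_graph // F_cycle_graph.
Qed.

Lemma deg_G31_leaf n : 3 < n -> deg (G31_leaf n) = 1.
Proof. by case/G31_leafE => i ->; apply: deg_attach_inr. Qed.

(** The old leaf passes from degree 1 to 2, which adds 7, and the new leaf adds 1. *)
Lemma F_index_G31' n : 4 < n ->
  F_index (G31' n) = F_index (Gk1 3 (n - 1)) + 8.
Proof.
move=> n5; have := F_index_attach (G31_leaf (n - 1)) 1.
rewrite deg_G31_leaf ?ltn_subRL //.
by rewrite exp1n => /addIn.
Qed.

(** The constant 35 = 27 + 8 comes from the two triangle vertices other than the centre; likewise 72
    = 64 + 8 for [G33] and 54 = 27 + 27 for [G34]. Each of the three graphs has [n - 3] leaves. *)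
Lemma F_index_Gk2 n : 4 < n ->
  F_index (Gk2 3 n) = (n - 2) ^ 3 + 35 + (n - 3).
Proof.
move=> n5.
have := F_index_attach (inl 1%R : attach (0%R : cycle_graph 3) (n - 3 - 1)) 1.
have := F_index_attach (0%R : cycle_graph 3) (n - 3 - 1).
rewrite deg_attach_inl !deg_cycle_graph // F_cycle_graph // mul0n addn0.
have -> : 2 + (n - 3 - 1) = n - 2 by lia.
have [-> ->] : 2 ^ 3 = 8 /\ (2 + 1) ^ 3 = 27 by [].
rewrite /Gk2; move: (F_index _) (F_index _); lia.
Qed.

Lemma F_index_G33 n : 4 < n ->
  F_index (G33 n) = (n - 3) ^ 3 + 72 + (n - 3).
Proof.
move=> n5.
have := F_index_attach (inl 1%R : attach (0%R : cycle_graph 3) (n - 5)) 2.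
have := F_index_attach (0%R : cycle_graph 3) (n - 5).
rewrite deg_attach_inl !deg_cycle_graph // F_cycle_graph // mul0n addn0.
have -> : 2 + (n - 5) = n - 3 by lia.
have [-> ->] : 2 ^ 3 = 8 /\ (2 + 2) ^ 3 = 64 by [].
rewrite /G33; move: (F_index _) (F_index _); lia.
Qed.

Lemma F_index_G34 n : 4 < n ->
  F_index (G34 n) = (n - 3) ^ 3 + 54 + (n - 3).
Proof.
move=> n5.
pose A1 := attach (0%R : cycle_graph 3) (n - 5).
pose A2 := attach (inl 1%R : A1) 1.
have := F_index_attach (inl (inl (2%:R)%R) : A2) 1.
have := F_index_attach (inl 1%R : A1) 1.
have := F_index_attach (0%R : cycle_graph 3) (n - 5).
rewrite !deg_attach_inl !deg_cycle_graph // F_cycle_graph // mul0n addn0.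
have -> : 2 + (n - 5) = n - 3 by lia.
have [-> ->] : 2 ^ 3 = 8 /\ (2 + 1) ^ 3 = 27 by [].
rewrite /G34; move: (F_index _) (F_index _) (F_index _); lia.
Qed.

Theorem theorem13 (n : nat) (hn : 6 <= n) :
  [/\ (unicyclic (Gk1 3 n) /\ order_of (Gk1 3 n) = n),
      (unicyclic (Gk2 3 n) /\ order_of (Gk2 3 n) = n),
      (unicyclic (G31' n) /\ order_of (G31' n) = n),
      (unicyclic (Gk1 4 n) /\ order_of (Gk1 4 n) = n) &
      (unicyclic (G33 n) /\ order_of (G33 n) = n) /\
      (unicyclic (G34 n) /\ order_of (G34 n) = n)]
  /\
  [/\ F_index (Gk1 3 n) > F_index (Gk2 3 n),
      F_index (Gk2 3 n) > F_index (G31' n),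
      F_index (G31' n) = F_index (Gk1 4 n),
      (6 < n -> F_index (Gk1 4 n) > F_index (G33 n)) &
      F_index (Gk1 4 n) > F_index (G34 n) /\
      F_index (G33 n) > F_index (G34 n)]
  /\
  (forall G : sgraph,
     unicyclic G -> order_of G = n ->
     ~ isomorphic G (Gk1 3 n) ->
     ~ isomorphic G (Gk2 3 n) ->
     ~ isomorphic G (G31' n) ->
     ~ isomorphic G (Gk1 4 n) ->
     ~ isomorphic G (G33 n) ->
     ~ isomorphic G (G34 n) ->
     F_index G < F_index (G34 n)).
Proof.
have n5 : 4 < n by apply: ltnW.
have n3 : 2 < n - 1 by rewrite ltn_subRL (leq_trans _ hn).
split; [|split].
- have [C3 C4] := (C3_unicyclic, C4_unicyclic).
  split; [| | | |split]; split.
  + exact: attach_unicyclic.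
  + by rewrite order_Gk1 // ltnW // ltnW.
  + by do 2!apply: attach_unicyclic.
  + by rewrite !order_attach order_cycle_graph //; clear -hn; lia.
  + by do 2!apply: attach_unicyclic.
  + by rewrite order_attach order_Gk1 ?subnK // (leq_trans _ hn).
  + exact: attach_unicyclic.
  + by rewrite order_Gk1 // ltnW.
  + by do 2!apply: attach_unicyclic.
  + by rewrite !order_attach order_cycle_graph //; clear -hn; lia.
  + by do 3!apply: attach_unicyclic.
  + by rewrite !order_attach order_cycle_graph //; clear -hn; lia.
- have := F_index_Gk1 n (isT : 2 < 4); have := F_index_Gk1 n (isT : 2 < 3).
  have := F_index_Gk1 (n - 1) (isT : 2 < 3).
  rewrite F_index_G31' // F_index_Gk2 // F_index_G33 // F_index_G34 //.
  move: (F_index _) (F_index _) (F_index _) => F1 F2 F3.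
  (* Writing [n = 6 + k] removes the truncated subtractions, and [cubeS] then expresses every cube
     through that of [k.+3]. *)
  clear n3 n5; move: hn => /subnKC <-; move: (n - 6) => k.
  have -> : 6 + k - 1 - 3 = k.+2 by lia.
  have -> : 6 + k - 3 = k.+3 by lia.
  have -> : 6 + k - 4 = k.+2 by lia.
  have -> : 6 + k - 2 = k.+4 by lia.
  rewrite (cubeS k.+4) !(cubeS k.+3).
  move: (k.+3 ^ 3) => K3.
  (* The comparison of [Gk1 4 n] with [G33 n] needs [0 < k]: for [n = 6] the graphs [G33 n] and
     [Gk2 3 n] are isomorphic, with F-index 102, against 90 for [Gk1 4 n]. *)
  by move=> *; split; [nia|nia|nia|nia|split; nia].
move=> G uniG oG n1 n2 n3' n4 n5' n6; have := unicyclic_F_index_lt uniG.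
rewrite oG F_index_G34 // => /(_ hn)[|//].
by case=> [/n1|/n2|[/n3'|/n4]|[/n5'|/n6]].
Qed.
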